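(* Let $n,\lambda,\mu,\nu$ be nonnegative integers with $\lambda>1+\mu+\nu$. Then \[\sum_{k=0}^n \frac{\binom{n}{k}\binom{\lambda n+k}{k}\binom{\mu n+n}{k}}{\binom{\nu n+k}{k}\binom{(\lambda-\mu-\nu-2)n+k}{k}}\Big\{H_{\mu n+n-k}-H_{(\lambda-\mu-\nu-2)n+k}\Big\} = \frac{\binom{(\lambda-\nu)n}{n}\binom{(\mu+\nu+2)n}{n}}{\binom{\nu n+n}{n}\binom{(\lambda-\mu-\nu-1)n}{n}}\Big\{H_{(\mu+\nu+1)n}-H_{(\mu+\nu+2)n}+H_{\mu n+n}-H_{(\lambda-\mu-\nu-1)n}\Big\}.\]
   Context: $H_0=0$ and $H_m=\sum_{j=1}^m \frac{1}{j}$ for positive integers $m$ (classical harmonic numbers). *)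

(* Defs.v *)
From mathcomp Require Import all_boot all_order all_algebra.
Set Implicit Arguments.
Unset Strict Implicit.
Unset Printing Implicit Defensive.
Import GRing.Theory.
Local Open Scope ring_scope.

Definition harmonic (m : nat) : rat := \sum_(1 <= j < m.+1) (j%:R)^-1.

(* Main.v *)
Require Import Defs.
From mathcomp Require Import all_boot all_order all_algebra.
From mathcomp Require Import ring zify.
Set Implicit Arguments.
Unset Strict Implicit.
Unset Printing Implicit Defensive.
Import GRing.Theory.
Local Open Scope ring_scope.

(** Cleared of denominators, the Pfaff-Saalschuetz summation is a polynomial
    identity valid in every commutative ring.  Instantiated in [{poly rat}] with
    the two parameters [mu n + n] and [(lam - mu - nu - 1) n] shifted by [+ 'X]
    and [- 'X], which keeps the series balanced, its value and its derivative
    at [0] are two identities whose combination is the claim: the logarithmic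
    derivative of a product of consecutive factors is a difference of harmonic
    numbers. *)

(** * Rising and falling factorials *)

Definition rising (R : comNzRingType) (x : R) k := \prod_(i < k) (x + i%:R).

Definition falling (R : comNzRingType) (x : R) k := \prod_(i < k) (x - i%:R).

Section Factorials.

Variable R : comNzRingType.
Implicit Type x : R.

Lemma rising0 x : rising x 0 = 1.
Proof. exact: big_ord0. Qed.

Lemma risingS x k : rising x k.+1 = rising x k * (x + k%:R).
Proof. exact: big_ord_recr. Qed.

Lemma rising_recl x k : rising x k.+1 = x * rising (x + 1) k.
Proof.
rewrite /rising big_ord_recl addr0; congr (_ * _); apply: eq_bigr => i _.
by rewrite lift0 -nat1r addrA.
Qed.

Lemma falling0 x : falling x 0 = 1.
Proof. exact: big_ord0. Qed.

Lemma fallingS x k : falling x k.+1 = falling x k * (x - k%:R).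
Proof. exact: big_ord_recr. Qed.

End Factorials.

(** * Pfaff-Saalschuetz summation without denominators, by creative telescoping *)

Section Saalschuetz.

Variables (R : comNzRingType) (a b c : R).

Let t n k : R := 'C(n, k)%:R * rising a k * falling b k
  * rising (c + k%:R) (n - k) * falling (a - b - c) (n - k).

(** Telescoping certificate: [t n.+1 k] is [t n k] times the factor that the closed form gains from
    [n] to [n.+1], plus [u n (k - 1) - u n k], which cancels on summation over [k]. *)
Let u n k : R := (a + k%:R) * (b - k%:R) * t n k.

Let saal_rec0 n : t n.+1 0 =
  (a - c - n%:R) * (c + b + n%:R) * t n 0 - u n 0.
Proof.
rewrite /u /t !bin0 !subn0 !addr0 subr0 !rising0 !falling0 risingS fallingS.
by ring.
Qed.

Let saal_recS n k : (k <= n)%N -> t n.+1 k.+1 =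
  (a - c - n%:R) * (c + b + n%:R) * t n k.+1 - u n k.+1 + u n k.
Proof.
rewrite leq_eqVlt => /predU1P[->|ltkn].
  rewrite /u /t !binn bin_small// !subnn !rising0 !falling0 risingS fallingS.
  by ring.
have [m def_n] : exists m, n = (k + m).+1 by exists (n - k.+1)%N; lia.
have bin_rel : 'C(n, k.+1)%:R * k.+1%:R = 'C(n, k)%:R * m.+1%:R :> R.
  rewrite -!natrM; congr _%:R; rewrite mulnC mul_bin_left mulnC; congr (_ * _)%N.
  by lia.
rewrite /u /t binS natrD subSS.
have -> : (n - k.+1 = m)%N by lia.
have -> : (n - k = m.+1)%N by lia.
rewrite (rising_recl (c + k%:R)) risingS !fallingS risingS.
have -> : c + k%:R + 1 = c + k.+1%:R by rewrite -addrA -natr1.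
set r := rising (c + _) m; set f := falling (a - b - c) m.
have -> : n%:R = k%:R + m%:R + 1 :> R by rewrite def_n -natr1 natrD.
move: bin_rel; rewrite -!natr1 => bin_rel.
set C1 : R := 'C(n, k)%:R in bin_rel *.
set C2 : R := 'C(n, k.+1)%:R in bin_rel *.
apply/eqP; rewrite -subr_eq0; apply/eqP.
(* [R] allows no division, so the difference of the two sides is exhibited as a multiple of the
   binomial relation [bin_rel]. *)
transitivity ((C1 * (m%:R + 1) - C2 * (k%:R + 1)) * (rising a k * falling b k
    * (a + k%:R) * (b - k%:R) * r * f * (a - b - c - m%:R))); first by ring.
by rewrite bin_rel subrr mul0r.
Qed.

Lemma saalschuetz n :
  \sum_(0 <= k < n.+1) ('C(n, k)%:R * rising a k * falling b k
     * rising (c + k%:R) (n - k) * falling (a - b - c) (n - k))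
  = falling (a - c) n * rising (c + b) n.
Proof.
elim: n => [|n IHn].
  by rewrite big_nat1 !rising0 !falling0 !mulr1.
rewrite -[LHS]/(\sum_(0 <= k < n.+2) t n.+1 k) big_nat_recl// saal_rec0.
under eq_big_nat => k /andP[_ ltkn] do rewrite (@saal_recS n k ltkn).
rewrite big_split sumrB -mulr_sumr /=.
have t_top : t n n.+1 = 0 by rewrite /t bin_small// !mul0r.
have u_top : u n n.+1 = 0 by rewrite /u t_top mulr0.
(* Since [t n] and [u n] vanish at [n.+1], shifting the index only loses the term at [0], which
   [saal_rec0] gives back. *)
have shift (v : nat -> R) : v n.+1 = 0 ->
    \sum_(0 <= k < n.+1) v k.+1 = \sum_(0 <= k < n.+1) v k - v 0.
  move=> v0; apply/eqP; rewrite eq_sym subr_eq addrC -big_nat_recl//.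
  by rewrite (big_nat_recr n.+1)//= v0 addr0.
rewrite (shift (t n))// (shift (u n))// IHn risingS fallingS.
by ring.
Qed.

End Saalschuetz.

(** * Harmonic numbers and logarithmic derivatives at 0 *)

Lemma harmonicS m : harmonic m.+1 = harmonic m + m.+1%:R^-1.
Proof. by rewrite /harmonic big_nat_recr. Qed.

Lemma natf_neq0 m : (0 < m)%N -> m%:R != 0 :> rat.
Proof. by rewrite Num.Theory.pnatr_eq0 lt0n. Qed.

Lemma fact_neq0 m : m`!%:R != 0 :> rat.
Proof. by rewrite natf_neq0 ?fact_gt0. Qed.

Lemma factS_rat m : m.+1`!%:R = m.+1%:R * m`!%:R :> rat.
Proof. by rewrite factS natrM. Qed.

Lemma bin_rat n k : (k <= n)%N ->
  'C(n, k)%:R = n`!%:R / (k`!%:R * (n - k)`!%:R) :> rat.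
Proof.
move=> lekn; apply/eqP; rewrite eq_sym.
by rewrite -(bin_fact lekn) !natrM mulfK// mulf_neq0 ?fact_neq0.
Qed.

(* [l] is the logarithmic derivative of [p] at [0], without dividing by [p.[0]]. *)
Definition has_logderiv0 (p : {poly rat}) v l :=
  p.[0] = v /\ p^`().[0] = v * l.

Lemma has_logderiv0M p q v w l m : has_logderiv0 p v l ->
  has_logderiv0 q w m -> has_logderiv0 (p * q) (v * w) (l + m).
Proof.
move=> [p0 dp] [q0 dq]; split; first by rewrite hornerM p0 q0.
by rewrite derivM hornerD !hornerM p0 q0 dp dq; ring.
Qed.

Lemma has_logderiv0_nat m : has_logderiv0 m%:R m%:R 0.
Proof. by rewrite -polyC_natr; split; rewrite ?hornerC// derivC horner0 mulr0. Qed.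

Lemma has_logderiv0_linear m (e : rat) : (0 < m)%N ->
  has_logderiv0 (m%:R + e *: 'X) m%:R (e / m%:R).
Proof.
move=> m_gt0; rewrite -polyC_natr; split; first by rewrite !hornerE.
by rewrite !derivE !hornerE /= mulrAC divff ?mul1r ?natf_neq0.
Qed.

(** Each factor [j + e X], for [j] from [q + 1] to [q + k], contributes [e / j]. Slope [e = 0]
    covers the factors that are not shifted. *)
Lemma has_logderiv0_rising q k (e : rat) :
  has_logderiv0 (rising (q.+1%:R + e *: 'X) k) ((q + k)`!%:R / q`!%:R)
    (e * (harmonic (q + k) - harmonic q)).
Proof.
elim: k => [|k IHk].
  rewrite rising0 addn0 subrr mulr0 divff ?fact_neq0//.
  exact: has_logderiv0_nat 1%N.
rewrite risingS addnS harmonicS factS_rat.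
have := has_logderiv0M IHk (@has_logderiv0_linear (q + k).+1 e isT).
congr has_logderiv0; [congr (_ * _) | | ].
- by rewrite addrAC -natrD addSn.
- by rewrite mulrC mulrA.
- by ring.
Qed.

Lemma has_logderiv0_falling m k (e : rat) : (k <= m)%N ->
  has_logderiv0 (falling (m%:R + e *: 'X) k) (m`!%:R / (m - k)`!%:R)
    (e * (harmonic m - harmonic (m - k))).
Proof.
elim: k => [|k IHk] lekm.
  rewrite falling0 subn0 subrr mulr0 divff ?fact_neq0//.
  exact: has_logderiv0_nat 1%N.
rewrite fallingS.
have gt0 : (0 < m - k)%N by rewrite subn_gt0.
have := has_logderiv0M (IHk (ltnW lekm)) (has_logderiv0_linear e gt0).
have -> : (m - k = (m - k.+1).+1)%N by rewrite subnSK.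
rewrite harmonicS factS_rat; congr has_logderiv0; [congr (_ * _) | | ].
- by rewrite subnSK// natrB ?(ltnW lekm)// addrAC.
- by rewrite invfM mulrA mulrAC divfK ?natf_neq0.
- by ring.
Qed.

(** * The harmonic identity with free parameters *)

Section HarmonicSum.

Variables (n m c e : nat).
Hypothesis lenm : (n <= m)%N.

(** The balancing condition: [a.+1 - m - c.+1] is then [e + n], the top of the last falling
    factorial in [p]. *)
Let a := (e + n + m + c)%N.

Let w k : rat := 'C(n, k)%:R * ((a + k)`!%:R / a`!%:R) * (m`!%:R / (m - k)`!%:R)
  * ((c + n)`!%:R / (c + k)`!%:R) * ((e + n)`!%:R / (e + k)`!%:R).

Let W : rat := (a - c)`!%:R / (a - c - n)`!%:R * ((c + m + n)`!%:R / (c + m)`!%:R).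

Let p k : {poly rat} :=
  'C(n, k)%:R * rising a.+1%:R k * falling (m%:R + 1 *: 'X) k
  * rising (c.+1%:R + k%:R) (n - k) * falling ((e + n)%:R + (-1) *: 'X) (n - k).

(** Only the two falling factorials move with ['X], in opposite directions, so only they contribute
    harmonic numbers. *)
Let has_logderiv0_p k : (k <= n)%N -> has_logderiv0 (p k) (w k)
  (harmonic m - harmonic (m - k) - harmonic (e + n) + harmonic (e + k)).
Proof.
move=> lekn.
have lekm := leq_trans lekn lenm.
have le2 : (n - k <= e + n)%N by lia.
have := has_logderiv0M (has_logderiv0M (has_logderiv0M (has_logderiv0M
  (has_logderiv0_nat 'C(n, k)) (has_logderiv0_rising a k 0))
  (has_logderiv0_falling 1 lekm)) (has_logderiv0_rising (c + k) (n - k) 0))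
  (has_logderiv0_falling (-1) le2).
rewrite !scale0r !addr0 -addSn natrD.
have -> : (c + k + (n - k) = c + n)%N by lia.
have -> : (e + n - (n - k) = e + k)%N by lia.
by congr has_logderiv0; ring.
Qed.

Let sum_p : \sum_(0 <= k < n.+1) p k =
  falling (a - c)%:R n * rising ((c + m).+1%:R + 1 *: 'X) n.
Proof.
have := saalschuetz (a.+1%:R : {poly rat}) (m%:R + 1 *: 'X) c.+1%:R n.
have -> : a.+1%:R - (m%:R + 1 *: 'X) - c.+1%:R = (e + n)%:R + (-1) *: 'X :> {poly rat}.
  by rewrite /a -!natr1 !natrD scaleN1r scale1r; ring.
have -> : a.+1%:R - c.+1%:R = (a - c)%:R :> {poly rat}.
  by rewrite -natrB ?subSS// ltnS /a leq_addl.
by rewrite addrA -natrD addSn.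
Qed.

Let has_logderiv0_sum_p : has_logderiv0 (\sum_(0 <= k < n.+1) p k) W
  (harmonic (c + m + n) - harmonic (c + m)).
Proof.
rewrite sum_p.
have le1 : (n <= a - c)%N by rewrite /a; lia.
have := has_logderiv0M (has_logderiv0_falling 0 le1)
  (has_logderiv0_rising (c + m) n 1).
by rewrite scale0r addr0 mul0r add0r mul1r.
Qed.

Let sum_w : \sum_(0 <= k < n.+1) w k = W.
Proof.
rewrite -has_logderiv0_sum_p.1 horner_sum; apply: eq_big_nat => k /andP[_ lekn].
by rewrite (has_logderiv0_p lekn).1.
Qed.

(** The logarithmic derivative of [p k] is a constant in [k] minus the wanted difference of harmonic
    numbers; the constant is summed by [sum_w], the rest by the derivative of [sum_p]. *)
Let sum_w_harmonic :
  \sum_(0 <= k < n.+1) w k * (harmonic (m - k) - harmonic (e + k)) =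
  W * (harmonic (c + m) - harmonic (c + m + n) + harmonic m - harmonic (e + n)).
Proof.
have := has_logderiv0_sum_p.2; rewrite raddf_sum horner_sum.
under eq_big_nat => k /andP[_ lekn] do rewrite (has_logderiv0_p lekn).2.
move=> dsum.
transitivity ((\sum_(0 <= k < n.+1) w k) * (harmonic m - harmonic (e + n))
  - W * (harmonic (c + m + n) - harmonic (c + m))); last by rewrite sum_w; ring.
rewrite -dsum mulr_suml -sumrB; apply: eq_bigr => k _.
by ring.
Qed.

Lemma saalschuetz_harmonic :
  \sum_(0 <= k < n.+1)
     ('C(n, k)%:R * 'C(a + k, k)%:R * 'C(m, k)%:R
       / ('C(c + k, k)%:R * 'C(e + k, k)%:R)
      * (harmonic (m - k) - harmonic (e + k)))
  = 'C(a - c, n)%:R * 'C(c + m + n, n)%:R / ('C(c + n, n)%:R * 'C(e + n, n)%:R)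
    * (harmonic (c + m) - harmonic (c + m + n) + harmonic m - harmonic (e + n)).
Proof.
(* [K] is the factor independent of [k] that turns [w k] into the quotient of binomials. *)
pose K : rat := c`!%:R * e`!%:R / ((c + n)`!%:R * (e + n)`!%:R).
transitivity (K * (W * (harmonic (c + m) - harmonic (c + m + n)
    + harmonic m - harmonic (e + n)))).
  rewrite -sum_w_harmonic mulr_sumr; apply: eq_big_nat => k /andP[_ lekn].
  rewrite mulrA; congr (_ * _).
  have lekm := @leq_trans n k m lekn lenm.
  rewrite /K /w !bin_rat ?leq_addl// !addnK.
  by field; rewrite ?fact_neq0.
rewrite mulrA; congr (_ * _).
have le1 : (n <= a - c)%N by rewrite /a; lia.
rewrite /K /W !bin_rat ?leq_addl// !addnK.
by field; rewrite ?fact_neq0.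
Qed.

End HarmonicSum.

Theorem theorem3 (n lam mu nu : nat) (hlam : (1 + mu + nu < lam)%N) :
  \sum_(0 <= k < n.+1)
     ('C(n, k)%:R * 'C(lam * n + k, k)%:R * 'C(mu * n + n, k)%:R
       / ('C(nu * n + k, k)%:R * 'C((lam - mu - nu - 2) * n + k, k)%:R)
      * (harmonic (mu * n + n - k) - harmonic ((lam - mu - nu - 2) * n + k)))
  = 'C((lam - nu) * n, n)%:R * 'C((mu + nu + 2) * n, n)%:R
      / ('C(nu * n + n, n)%:R * 'C((lam - mu - nu - 1) * n, n)%:R)
    * (harmonic ((mu + nu + 1) * n) - harmonic ((mu + nu + 2) * n)
       + harmonic (mu * n + n) - harmonic ((lam - mu - nu - 1) * n)) :> rat.
Proof.
(* By [hlam] the truncated subtraction is exact; writing [lam] through [d] removes it everywhere. *)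
have [d ->] : exists d, lam = (d + mu + nu + 2)%N.
  by exists (lam - mu - nu - 2)%N; lia.
have -> : (d + mu + nu + 2 - mu - nu - 2 = d)%N by lia.
have -> : (d + mu + nu + 2 - mu - nu - 1 = d + 1)%N by lia.
have -> : (d + mu + nu + 2 - nu = d + mu + 2)%N by lia.
(* With [c = nu n], [e = d n] and [m = mu n + n], the balanced parameter [a] is [lam n]. *)
have := saalschuetz_harmonic (nu * n) (d * n) (leq_addl (mu * n) n).
have -> : (d * n + n + (mu * n + n) + nu * n = (d + mu + nu + 2) * n)%N by lia.
have -> : ((d + mu + nu + 2) * n - nu * n = (d + mu + 2) * n)%N by lia.
have -> : (nu * n + (mu * n + n) + n = (mu + nu + 2) * n)%N by lia.
have -> : (nu * n + (mu * n + n) = (mu + nu + 1) * n)%N by lia.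
by have -> : (d * n + n = (d + 1) * n)%N by lia.
Qed.
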